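(* Let $(c_1,\dots,c_k)$ be a composition of $n$, let $\mathfrak p\subset\mathfrak{sl}(n,\mathbb C)$ be the corresponding standard parabolic subalgebra, and let $e+V$ be the canonical Weierstrass section. Let $x_{i,j},x_{k',l}$ be a bad VS pair for $e+V$. Then the connecting element $x_{j,k'}$ comes from a line carrying a $\ast$, equivalently $x_{j,k'}\in\operatorname{supp}V$. In particular $(i,j,k',l)$ is a VS quadruplet.
   Context: **Diagram.** A composition $(c_1,\dots,c_k)$ of $n$ into positive integers defines top-aligned columns $C_1,\dots,C_k$ (from left to right), $C_i$ having $c_i$ boxes. Boxes are numbered $1,\dots,n$ down the columns, taking columns from left to right; a box is identified with its number. $C_{(t)}$ is the column containing box $t$. **Canonical filling.** This places labels $1$ and $\ast$ at certain positions $(i,j)$, box $j$ lying in a column strictly to the right of that of $i$ (''the line joining $i,j$ carries a $1$ or a $\ast$''). It is built by adding columns from left to right; adding a column does not change the labels between earlier columns; a single column has no labels. Let $S=(C_1,\dots,C_{k-1})$ be nonempty and already filled, $|S|$ its greatest column height, $\mathscr S$ its set of column heights. For $s\ge1$ adjoin a last column $C_k(s)$ of height $s$. Its column block $\mathbf C_k(s)$ has positions (row $r$, column $t$), $r$ a box of $S$, $t\in[1,s]$, standing for the pair ($r$, $t$-th box from the top of $C_k(s)$); $\mathbf C_k(s)^t$ is its $t$-th column. For a nonempty set $F$ of boxes of $S$, let $\mathrm{sel}(F)$ be the highest box of $F$ in the rightmost column of $S$ meeting $F$. The labels of $\mathbf C_k(s)$ are given recursively in $s$. - $s=1$: in the row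 of the top box of $C_{k-1}$ put $\ast$ if $1\in\mathscr S$ and $1$ otherwise; then apply rule (4) below to column $1$. - $\mathbf C_k(s+1)$ from $\mathbf C_k(s)$: (1) columns $t<s$ are unchanged; (2) if $\mathbf C_k(s)^s$ has a $\ast$ in row $r'$, then $\mathbf C_k(s+1)^s$ has as only label a $1$ in row $r'$; otherwise column $s$ is unchanged; (3) column $s+1$: (A) if $\mathbf C_k(s)^s$ has a $\ast$ and also a $1$, the latter in row $r$, put in row $r$ a $\ast$ if $s+1\in\mathscr S$, a $1$ otherwise; (B) if $\mathbf C_k(s)^s$ has a $1$ and no $\ast$, and $s+1\le|S|$, put in row $\mathrm{sel}(F)$ a $\ast$ if $s+1\in\mathscr S$, a $1$ otherwise, where $F$ is the set of boxes of $S$ whose row has no $1$ in the filling of $S$ nor in columns $1,\dots,s$ of $\mathbf C_k(s+1)$; (C) in all other cases column $s+1$ is empty; (4) if the column just created (column $s+1$, or column $1$ when starting) contains a $\ast$, let $F$ be the set of boxes of $S$, different from the row of this $\ast$, whose row has no $1$ in the filling of $S$ nor in the preceding columns of the block; if $F\ne\emptyset$, put also a $1$ in row $\mathrm{sel}(F)$ of this column. The filling of $(c_1,\dots,c_k)$ is that of $S$ together with $\mathbf C_k(c_k)$. **Parabolic and section.** $x_{i,j}$ denotes the matrix unit. $\mathfrak p$ is the algebra of traceless block upper triangular matrices with diagonal blocks of sizes $c_1,\dots,c_k$: $x_{a,b}$ ($a\ne b$) is a root vector of $\mathfrak p$ iff $C_{(a)}=C_{(b)}$ or $C_{(a)}$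 is to the left of $C_{(b)}$. Its nilradical $\mathfrak m$ has basis the $x_{a,b}$ with $C_{(a)}$ strictly left of $C_{(b)}$. $\operatorname{supp}e$ (resp. $\operatorname{supp}V$) is the set of $x_{i,j}$ with $(i,j)$ labelled $1$ (resp. $\ast$); $e$ is the sum of the elements of $\operatorname{supp}e$ and $V$ the span of $\operatorname{supp}V$. **VS pairs.** A pair $x_{i,j},x_{k',l}\in\operatorname{supp}e$ with $j\ne k'$ is a VS pair for $e+V$ if neither $x_{i,k'}$ nor $x_{j,l}$ belongs to $\operatorname{supp}V$ and $x_{j,k'}$ is a root vector of $\mathfrak p$, called the connecting element. It gives a VS quadruplet $(i,j,k',l)$ if $x_{j,k'}\in\operatorname{supp}V$. A VS pair is bad if there is no $z$ with $x_{j,z}\in\operatorname{supp}e$ and $x_{z,l}$ a root vector of $\mathfrak p$, and there is no $y$ with $x_{y,k'}\in\operatorname{supp}e$ and $x_{i,y}$ a root vector of $\mathfrak p$. *)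

(* Defs.v *)
From mathcomp Require Import all_boot all_order all_algebra.
From mathcomp Require Import classical_sets reals complex.

Set Implicit Arguments.
Unset Strict Implicit.
Unset Printing Implicit Defensive.

Import GRing.Theory.

Local Open Scope ring_scope.
Local Open Scope classical_set_scope.

Definition is_composition (c : seq nat) (n : nat) : Prop :=
  all (fun h => 0 < h)%N c /\ sumn c = n.

(* Boxes are numbered from 0 (not from 1), so that they match 'I_n, down the columns
   and from left to right, so that [reshape_index c t] is the index, from the
   left, of the column C_(t) containing box t. *)
Definition column_of (c : seq nat) (t : nat) : nat := reshape_index c t.

(* The labels in one column of a column block: the row (a box) carrying a 1 and
   the row carrying a star, if any.  The rules below never put two equal labels
   in the same column. *)
Record labels := Labels { one_row : option nat; star_row : option nat }.

Definition no_labels := Labels None None.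

(* A filling lists one [labels] per box: its entry number j holds the labels of
   all positions (i, j).  Thus the filling of S followed by the columns of a
   column block is the filling obtained by adjoining that block. *)
Definition has_one (f : seq labels) (r : nat) : bool :=
  has (fun q => one_row q == Some r) f.

(* The boxes of S whose row has no 1 in f, in increasing order. *)
Definition free_rows (S : seq nat) (f : seq labels) : seq nat :=
  [seq r <- iota 0 (sumn S) | ~~ has_one f r].

(* F must be increasing: the first box of F in a column is then the highest one.
   The value is None exactly when F is empty. *)
Definition sel (S : seq nat) (F : seq nat) : option nat :=
  let m := (\max_(r <- F) column_of S r)%N in
  ohead [seq r <- F | column_of S r == m].

(* Column t (counted from 1) of a block, whose main label goes in row r; f is the
   filling of S followed by the preceding columns of the block.  If the main
   label is a star, the column also gets a 1 in row sel(F) if F is nonempty, where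
   F is the set of the other free rows. *)
Definition place (S : seq nat) (f : seq labels) (t r : nat) : labels :=
  if t \in S
  then Labels (sel S [seq x <- free_rows S f | x != r]) (Some r)
  else Labels (Some r) None.

(* b is the block C_k(s), f the filling of S, and the result is C_k(s+1).  The
   star of q, the last column of b, turns into a 1, replacing any former 1.  The
   inner match on [sel] only serves to extract its value. *)
Definition next_block (S : seq nat) (f b : seq labels) : seq labels :=
  let s := size b in
  let q := last no_labels b in
  let q' := if star_row q is Some r' then Labels (Some r') None else q in
  let b' := rcons (take s.-1 b) q' in
  let new :=
    match star_row q, one_row q with
    | Some _, Some r => place S (f ++ b') s.+1 r
    | None, Some _ =>
        if (s.+1 <= \max_(h <- S) h)%N then
          if sel S (free_rows S (f ++ b')) is Some r
          then place S (f ++ b') s.+1 r else no_labels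
        else no_labels
    | _, None => no_labels
    end in
  rcons b' new.

(* The block C_k(s) of size s; [flatten_index S (size S).-1 0] is the top box of
   the last column C_{k-1} of S. *)
Fixpoint block (S : seq nat) (f : seq labels) (s : nat) : seq labels :=
  match s with
  | 0 => [::]
  | 1 => [:: place S f 1 (flatten_index S (size S).-1 0)]
  | s'.+1 => next_block S f (block S f s')
  end.

Definition add_column (Sf : seq nat * seq labels) (h : nat) :
    seq nat * seq labels :=
  let S := Sf.1 in let f := Sf.2 in
  (rcons S h, f ++ (if nilp S then nseq h no_labels else block S f h)).

Definition filling (c : seq nat) : seq labels :=
  (foldl add_column ([::], [::]) c).2.

Lemma filling_rcons (S : seq nat) (h : nat) :
  filling (rcons S h) =
    filling S ++ (if nilp S then nseq h no_labels else block S (filling S) h).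
Proof.
have foldl1 c : (foldl add_column ([::], [::]) c).1 = c.
  elim/last_ind: c => [//|c x IHc]; rewrite foldl_rcons.
  by rewrite /= IHc.
by rewrite /filling foldl_rcons /= foldl1.
Qed.

Definition carries_one (c : seq nat) (i j : nat) : bool :=
  one_row (nth no_labels (filling c) j) == Some i.

Definition carries_star (c : seq nat) (i j : nat) : bool :=
  star_row (nth no_labels (filling c) j) == Some i.

(* The field of complex numbers is [complex R] for R : realType. *)
Definition matrix_unit (R : realType) (n : nat) (i j : 'I_n) :
  'M[complex R]_n := delta_mx i j.

Definition parabolic (R : realType) (n : nat) (c : seq nat) :
    set 'M[complex R]_n :=
  [set A | \tr A = 0 /\
    forall a b : 'I_n, (column_of c b < column_of c a)%N -> A a b = 0].

(* Root vectors with respect to the diagonal Cartan subalgebra of sl(n), up to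
   scalars. *)
Definition root_vector (R : realType) (n : nat) (c : seq nat) :
    set 'M[complex R]_n :=
  [set x | exists a b : 'I_n,
    [/\ a != b, x = matrix_unit R a b & parabolic c x]].

Definition supp_e (R : realType) (n : nat) (c : seq nat) :
    set 'M[complex R]_n :=
  [set x | exists i j : 'I_n,
    carries_one c i j /\ x = matrix_unit R i j].

Definition supp_V (R : realType) (n : nat) (c : seq nat) :
    set 'M[complex R]_n :=
  [set x | exists i j : 'I_n,
    carries_star c i j /\ x = matrix_unit R i j].

(* The section e + V; everything below only involves supp e and supp V. *)
Definition section_e (R : realType) (n : nat) (c : seq nat) :
    'M[complex R]_n :=
  \sum_(i < n) \sum_(j < n | carries_one c i j) matrix_unit R i j.

Definition section_V (R : realType) (n : nat) (c : seq nat) :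
    {vspace 'M[complex R]_n} :=
  (\sum_(i < n) \sum_(j < n | carries_star c i j) <[matrix_unit R i j]>)%VS.

Definition weierstrass_section (R : realType) (n : nat) (c : seq nat) :
    set 'M[complex R]_n :=
  [set x | exists2 v, v \in section_V R n c & x = section_e R n c + v].

Definition VS_pair (R : realType) (n : nat) (c : seq nat)
    (i j k' l : 'I_n) : Prop :=
  [/\ supp_e c (matrix_unit R i j) /\ supp_e c (matrix_unit R k' l),
      j != k',
      ~ supp_V c (matrix_unit R i k'),
      ~ supp_V c (matrix_unit R j l)
    & root_vector c (matrix_unit R j k')].

Definition VS_quadruplet (R : realType) (n : nat) (c : seq nat)
    (i j k' l : 'I_n) : Prop :=
  VS_pair R c i j k' l /\ supp_V c (matrix_unit R j k').

Definition bad_VS_pair (R : realType) (n : nat) (c : seq nat)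
    (i j k' l : 'I_n) : Prop :=
  [/\ VS_pair R c i j k' l,
      ~ (exists z : 'I_n, supp_e c (matrix_unit R j z) /\
                          root_vector c (matrix_unit R z l))
    & ~ (exists y : 'I_n, supp_e c (matrix_unit R y k') /\
                          root_vector c (matrix_unit R i y))].

Lemma matrix_unit_inj (R : realType) (n : nat) (i j i' j' : 'I_n) :
  matrix_unit R i j = matrix_unit R i' j' -> i = i' /\ j = j'.
Proof.
move=> /matrixP/(_ i j); rewrite !mxE !eqxx /=.
by case: eqP => [->|_]; case: eqP => [->|_] // /eqP; rewrite oner_eq0.
Qed.

Lemma root_vectorP (R : realType) (n : nat) (c : seq nat) (a b : 'I_n) :
  root_vector c (matrix_unit R a b) <->
  a != b /\ (column_of c a <= column_of c b)%N.
Proof.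
split=> [[a' [b' [ab' /matrix_unit_inj[-> ->] [_ up]]]]|[ab le_ab]].
  split=> //; rewrite leqNgt; apply/negP => /up /eqP.
  by rewrite mxE !eqxx oner_eq0.
exists a, b; split=> //; split.
  rewrite /mxtrace big1 // => x _; rewrite mxE.
  by case: eqP => [->|] //; rewrite (negPf ab).
move=> x y lt_yx; rewrite mxE.
by case: eqP => [ex|] //; case: eqP => [ey|] //; rewrite ex ey ltnNge le_ab in lt_yx.
Qed.

Lemma supp_eP (R : realType) (n : nat) (c : seq nat) (i j : 'I_n) :
  supp_e c (matrix_unit R i j) <-> carries_one c i j.
Proof.
split=> [[a [b [lab /matrix_unit_inj[-> ->]]]] //|lab].
by exists i, j.
Qed.

Lemma supp_VP (R : realType) (n : nat) (c : seq nat) (i j : 'I_n) :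
  supp_V c (matrix_unit R i j) <-> carries_star c i j.
Proof.
split=> [[a [b [lab /matrix_unit_inj[-> ->]]]] //|lab].
by exists i, j.
Qed.

(* Main.v *)
(* List the rows of S that carry no 1 in the order r_1, r_2, ... in which sel picks
   them: columns from right to left, each column from top to bottom.  The number of
   such rows is at most |S| + 1, so the bound s + 1 <= |S| of rule (B) never binds,
   and C_k(s) has a closed form: its t-th column has a 1 in row r_t, except that if
   s is a height of S, then its last column has a star in row r_s and its 1 in row
   r_{s+1}.  In particular r_s is then the only row skipped by the block.

   Let x_{i,j}, x_{k',l} be a bad VS pair.  Badness on the side of l says that row j
   has no 1 up to the column of l.  If C_(j) = C_(k') with j above k', then j comes
   before k' in the list used for C_(l), hence is the skipped row and (j,l) has a
   star; if j is below k', then the row of the 1 in column k' comes before i in the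
   list used for C_(j), against badness on the side of i.  So C_(j) is left of
   C_(k').  In the list used for C_(k'), row j must then be the skipped row or lie
   beyond all the rows used; but the 1 of column k' is not in a row preceding j, by
   badness on the side of i.  This leaves only the case where j is the skipped row
   and k' is the last box of its column, that is, (j,k') has a star. *)

Require Import Defs.
From mathcomp Require Import all_boot all_order all_algebra.
From mathcomp Require Import classical_sets reals complex.
From mathcomp Require Import zify.

Set Implicit Arguments.
Unset Strict Implicit.
Unset Printing Implicit Defensive.

(** * The order in which [sel] picks rows *)

Definition box_le (S : seq nat) : rel nat := fun x y =>
  (column_of S y < column_of S x) ||
  (column_of S x == column_of S y) && (x <= y).

Lemma box_le_total S : total (box_le S).
Proof. by rewrite /box_le => x y; lia. Qed.

Lemma box_le_trans S : transitive (box_le S).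
Proof. by rewrite /box_le => y x z; lia. Qed.

Definition greedy_order (S : seq nat) (f : seq labels) : seq nat :=
  sort (box_le S) (free_rows S f).

(** The least box for [box_le] lies in the rightmost column met by [F], and since [F] is increasing,
    it is the first box of [F] in that column. *)
Lemma sel_sort S F : sorted ltn F -> sel S F = ohead (sort (box_le S) F).
Proof.
move=> Fs; case E: (sort (box_le S) F) => [|x s].
  have : size F = 0 by rewrite -(size_sort (box_le S)) E.
  by move/size0nil->; rewrite /sel big_nil.
have xF : x \in F by rewrite -(mem_sort (box_le S)) E mem_head.
have minx y : y \in F -> box_le S x y.
  rewrite -(mem_sort (box_le S)) E inE => /predU1P[->|ys].
    by rewrite /box_le eqxx leqnn orbT.
  have := sort_sorted (@box_le_total S) F; rewrite E /=.
  by move=> /(order_path_min (@box_le_trans S))/allP; apply.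
rewrite /sel; set m := (\max_(r <- F) _).
have -> : m = column_of S x.
  apply/eqP; rewrite eqn_leq (leq_bigmax_seq _ xF) // andbT.
  by apply/bigmax_leqP_seq => y /minx; rewrite /box_le; lia.
set G := filter _ F.
have Gs : sorted ltn G by apply: sorted_filter Fs; apply: ltn_trans.
have xG : x \in G by rewrite mem_filter eqxx.
have : forall y, y \in G -> x <= y.
  by move=> y; rewrite mem_filter => /andP[/eqP cy /minx]; rewrite /box_le cy; lia.
case: G Gs xG => [//|y G] /= /(order_path_min ltn_trans)/allP yG.
rewrite inE => /predU1P[-> //|/yG /= yx /(_ y (mem_head _ _))]; lia.
Qed.

Lemma sorted_free_rows S f : sorted ltn (free_rows S f).
Proof. exact/sorted_filter/iota_ltn_sorted/ltn_trans. Qed.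

Lemma mem_greedy S f r :
  (r \in greedy_order S f) = (r < sumn S) && ~~ has_one f r.
Proof. by rewrite mem_sort mem_filter mem_iota andbC. Qed.

Lemma greedy_uniq S f : uniq (greedy_order S f).
Proof. by rewrite sort_uniq filter_uniq ?iota_uniq. Qed.

(** Sorting commutes with filtering, so every choice made by [sel] among free rows is read off one
    fixed list. *)
Lemma sel_filter S f p :
  sel S [seq r <- free_rows S f | p r] =
  ohead [seq r <- greedy_order S f | p r].
Proof.
rewrite sel_sort; last exact/sorted_filter/sorted_free_rows/ltn_trans.
by rewrite filter_sort //; [apply: box_le_total | apply: box_le_trans].
Qed.

Lemma ohead_drop (T : Type) (s : seq T) n : ohead (drop n s) = onth s n.
Proof. by elim: s n => [|x s IHs] [|n] //=; rewrite IHs. Qed.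

Lemma filter_notin_take (T : eqType) (s : seq T) n :
  uniq s -> [seq x <- s | x \notin take n s] = drop n s.
Proof.
move=> us; rewrite -[X in filter _ X](cat_take_drop n s) filter_cat.
rewrite (eq_in_filter (a2 := pred0)) => [|x ->//]; rewrite filter_pred0 /=.
rewrite (eq_in_filter (a2 := predT)) ?filter_predT // => x xd.
move: us; rewrite -(cat_take_drop n s) cat_uniq cat_take_drop =>
    /and3P[_ /hasPn nd _].
exact: nd.
Qed.

Lemma mem_take_onth (T : eqType) (s : seq T) n x :
  reflect (exists2 t, t < n & onth s t = Some x) (x \in take n s).
Proof.
apply: (iffP idP).
  elim: s n => [|y s IHs] [|n] //=; rewrite inE => /predU1P[->|/IHs[t tn ts]].
    by exists 0.
  by exists t.+1.
case=> t; elim: s n t => [|y s IHs] [|n] [|t] //= tn.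
  by case=> ->; rewrite mem_head.
by move=> /IHs; rewrite inE => ->; rewrite ?orbT.
Qed.

(** * The closed form of a column block *)

(** The columns of a block before its last one. Past the end of [L], [onth] gives [None], that is,
    an empty column. *)
Definition greedy_ones (L : seq nat) (s : nat) : seq labels :=
  mkseq (fun t => Labels (onth L t) None) s.

Lemma has_one_greedy L s r : has_one (greedy_ones L s) r = (r \in take s L).
Proof.
rewrite /has_one has_map; apply/hasP/mem_take_onth => [[t]|[t ts Lt]].
  by rewrite mem_iota => ts /eqP /= Lt; exists t.
by exists t; rewrite ?mem_iota //= Lt.
Qed.

Lemma has_one_cat f g r : has_one (f ++ g) r = has_one f r || has_one g r.
Proof. exact: has_cat. Qed.

Lemma free_rows_greedy S f s :
  free_rows S (f ++ greedy_ones (greedy_order S f) s) =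
  [seq r <- free_rows S f | r \notin take s (greedy_order S f)].
Proof.
rewrite /free_rows -filter_predI; apply: eq_filter => r /=.
by rewrite has_one_cat has_one_greedy negb_or andbC.
Qed.

(* Here t counts the columns from 0, so [onth L t] is the row r_{t+1}. *)
Definition greedy_label (S L : seq nat) (s t : nat) : labels :=
  if (t.+1 == s) && (s \in S) then Labels (onth L s) (onth L t)
  else Labels (onth L t) None.

Definition greedy_block (S L : seq nat) (s : nat) : seq labels :=
  mkseq (greedy_label S L s) s.

Lemma greedy_blockS S L s :
  greedy_block S L s.+1 =
  rcons (greedy_ones L s) (greedy_label S L s.+1 s).
Proof.
rewrite /greedy_block mkseqS; congr rcons.
apply/eq_in_map => t; rewrite mem_iota /greedy_label => ts.
by case: eqP => // -[e]; move: ts; rewrite e; lia.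
Qed.

(** The rows still free form [drop s L], with head [r]; the 1 that accompanies a star therefore goes
    to the next entry, [onth L s.+1]. *)
Lemma place_greedy S f s r (L := greedy_order S f) :
  onth L s = Some r ->
  place S (f ++ greedy_ones L s) s.+1 r = greedy_label S L s.+1 s.
Proof.
move=> Ls; rewrite /place /greedy_label eqxx andTb Ls; case: ifP => // _.
congr Labels.
rewrite free_rows_greedy -filter_predI sel_filter filter_predI.
rewrite filter_notin_take ?greedy_uniq // -/L -ohead_drop.
have lt_s : s < size L by rewrite -onthTE Ls.
have ud : uniq (drop s L) by rewrite drop_uniq // greedy_uniq.
move: (ud); rewrite (drop_nth 0 lt_s) (onth_nth 0 _ _ _ Ls) [filter _ _]/= eqxx.
rewrite cons_uniq => /andP[rd _].
rewrite (eq_in_filter (a2 := predT)) ?filter_predT ?ohead_drop // => x xd.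
by apply/eqP => xr; rewrite -xr xd in rd.
Qed.

Lemma bigmax_mem (S : seq nat) :
  0 < \max_(h <- S) h -> \max_(h <- S) h \in S.
Proof.
elim: S => [|h S IHS]; first by rewrite big_nil.
rewrite big_cons inE /maxn; case: ifP => [_ /IHS ->|_]; rewrite ?orbT //.
by rewrite eqxx.
Qed.

Lemma sel_greedy S f s :
  sel S (free_rows S (f ++ greedy_ones (greedy_order S f) s)) =
  onth (greedy_order S f) s.
Proof.
by rewrite free_rows_greedy sel_filter filter_notin_take ?greedy_uniq // ohead_drop.
Qed.

(** Induction on the height. The old last column keeps only a 1, in row [onth L s], and the new main
    label goes to [onth L s.+1]: in (A) this is the row of the 1 just removed, in (B) the next
    choice of [sel]. *)
Lemma block_greedy S f s (L := greedy_order S f) :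
    size L <= (\max_(h <- S) h).+1 ->
    onth L 0 = Some (flatten_index S (size S).-1 0) ->
  block S f s.+1 = greedy_block S L s.+1.
Proof.
move=> szL L0; elim: s => [|s IHs].
  by rewrite greedy_blockS /= -(place_greedy L0) /greedy_ones cats0.
have -> : block S f s.+2 = next_block S f (block S f s.+1) by [].
rewrite IHs !greedy_blockS /next_block last_rcons size_rcons size_mkseq /=.
have -> x : take s (rcons (greedy_ones L s) x) = greedy_ones L s.
  by rewrite -cats1 take_size_cat ?size_mkseq.
have step n : onth L n = None -> onth L n.+1 = None.
  by move=> Ln; apply: onth_default; rewrite leqW // -onthNE Ln.
set q := greedy_label S L s.+1 s.
have q_one : one_row q = if s.+1 \in S then onth L s.+1 else onth L s.
  by rewrite /q /greedy_label eqxx andTb; case: ifP.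
have q_star : star_row q = if s.+1 \in S then onth L s else None.
  by rewrite /q /greedy_label eqxx andTb; case: ifP.
have -> : (if star_row q is Some r' then Labels (Some r') None else q) =
          Labels (onth L s) None.
  rewrite q_star; case: ifP => sS; last by rewrite /q /greedy_label eqxx sS.
  by case Ls: (onth L s) => //; rewrite /q /greedy_label eqxx sS Ls step.
rewrite -mkseqS -/(greedy_ones L s.+1) q_one q_star; congr rcons.
case Ls1: (onth L s.+1) => [r|]; last first.
  have -> : greedy_label S L s.+2 s.+1 = no_labels.
    by rewrite /greedy_label eqxx andTb Ls1 step //; case: ifP.
  rewrite sel_greedy Ls1; case: ifP => _; case: (onth L s) => //.
  by move=> r; case: ifP.
case Ls: (onth L s) => [r'|]; last by move: (step _ Ls); rewrite Ls1.
rewrite sel_greedy Ls1 -(place_greedy Ls1); case: ifP => // sS.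
have lt_s : s.+1 < size L by rewrite -onthTE Ls1.
(* If the bound of (B) failed, [s.+1 < size L] would force [s.+1] to be the greatest height, hence a
   height of [S], against [sS]. *)
rewrite ifT // ltnNge; apply/negP => le_max; case/negP: (negbT sS).
have -> : s.+1 = \max_(h <- S) h by lia.
by apply: bigmax_mem; lia.
Qed.

(** * Positions in lists, and boxes located by partial sums of heights *)

Lemma onth_drop (T : Type) (s : seq T) n i :
  onth (drop n s) i = onth s (n + i).
Proof. by elim: s n => [|x s IHs] [|n] //=; rewrite onth0n. Qed.

Lemma mem_drop_onth (T : eqType) (s : seq T) n v x :
  n <= v -> onth s v = Some x -> x \in drop n s.
Proof. by move=> nv sv; apply/onthP; exists (v - n); rewrite onth_drop subnKC. Qed.

Lemma leq_sumn_take c p q : p <= q -> sumn (take p c) <= sumn (take q c).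
Proof.
move=> le_pq; rewrite -(take_takel c le_pq).
by rewrite -[X in _ <= sumn X](cat_take_drop p) sumn_cat leq_addr.
Qed.

Lemma sumn_takeS c q : sumn (take q.+1 c) = sumn (take q c) + nth 0 c q.
Proof.
have [lt_q|le_q] := ltnP q (size c); first by rewrite (take_nth 0) // sumn_rcons.
by rewrite !take_oversize ?(leqW le_q) // nth_default // addn0.
Qed.

Lemma box_bounds c b (q := column_of c b) :
  b < sumn c -> sumn (take q c) <= b < sumn (take q c) + nth 0 c q.
Proof.
move=> lt_b; have := reshape_offsetP lt_b; have := reshape_indexK c b.
by rewrite /flatten_index /reshape_offset -/(column_of c b) -/q; lia.
Qed.

Lemma ltn_sumn_take c q b :
  b < sumn c -> (b < sumn (take q c)) = (column_of c b < q).
Proof.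
move=> /box_bounds /andP[ge_b]; rewrite -sumn_takeS => lt_b.
by case: (ltnP (column_of c b) q) => /(leq_sumn_take c); lia.
Qed.

Lemma column_of_flatten c q t :
  t < nth 0 c q -> column_of c (sumn (take q c) + t) = q.
Proof. exact: flatten_indexKl. Qed.

Lemma column_of_take c q b :
  b < sumn (take q c) -> column_of (take q c) b = column_of c b.
Proof.
move=> lt_b; have := box_bounds lt_b; have := reshape_indexP lt_b.
rewrite -/(column_of _ _) size_take_min; set a := column_of (take q c) b => lt_a.
have lt_aq : a < q by lia.
rewrite (take_takel _ (ltnW lt_aq)) nth_take // => bnd.
have -> : b = sumn (take a c) + (b - sumn (take a c)) by lia.
by rewrite column_of_flatten //; lia.
Qed.

(** * The closed form of the filling, column after column *)

Lemma has_one_greedy_block S L h r :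
  has_one (greedy_block S L h.+1) r =
  (r \in take h L) || (onth L (if h.+1 \in S then h.+1 else h) == Some r).
Proof.
rewrite greedy_blockS /has_one has_rcons -/(has_one _ r) has_one_greedy orbC.
by rewrite /greedy_label eqxx andTb; case: ifP.
Qed.

(** No row of the last column carries a 1 yet, so its top box is free and comes first: this is where
    the initial rule puts the main label. *)
Lemma greedy_order_head S f :
    all (leq 1) S -> ~~ nilp S ->
    (forall r, has_one f r -> r < sumn (take (size S).-1 S)) ->
  onth (greedy_order S f) 0 = Some (flatten_index S (size S).-1 0).
Proof.
move=> posS S_neq0 f_row; set q := (size S).-1; set x := flatten_index S q 0.
have lt_q : q < size S by rewrite /q; case: (S) S_neq0.
have pos_q : 0 < nth 0 S q by apply: (allP posS); apply: mem_nth.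
have col_x : column_of S x = q by apply: flatten_indexKl.
have xE : x = sumn (take q S) by rewrite /x /flatten_index addn0.
have xL : x \in greedy_order S f.
  rewrite mem_greedy; apply/andP; split; last first.
    by apply/negP => /f_row; rewrite xE ltnn.
  by have := leq_sumn_take S lt_q; rewrite sumn_takeS take_size xE; lia.
have minx y : y \in greedy_order S f -> box_le S x y.
  rewrite mem_greedy => /andP[lt_y _]; have := reshape_indexP lt_y.
  have := ltn_sumn_take q lt_y; rewrite /box_le col_x xE -/(column_of _ _); lia.
have := sort_sorted (@box_le_total S) (free_rows S f).
move: xL minx; rewrite -/(greedy_order S f).
case: (greedy_order S f) => [//|y s] + minx /= /(order_path_min (@box_le_trans S)).
rewrite inE => /predU1P[-> //|xs] /allP/(_ _ xs).
have := minx y (mem_head _ _); rewrite /box_le => ? ?; congr Some; lia.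
Qed.

Lemma filling_greedyS S h :
    all (leq 1) S -> 0 < h ->
    size (greedy_order S (filling S)) <= (\max_(k <- S) k).+1 ->
    (forall r, has_one (filling S) r -> r < sumn (take (size S).-1 S)) ->
  filling (rcons S h) =
    filling S ++ greedy_block S (greedy_order S (filling S)) h.
Proof.
case: h => // h posS _ szL f_row; rewrite filling_rcons; case: ifP => S_neq0.
  (* With no earlier column the list is empty, and the closed form has only empty columns. *)
  congr cat; rewrite (nilP S_neq0); apply/esym.
  rewrite /greedy_block -(@eq_mkseq _ (fun=> no_labels)).
    apply: (@eq_from_nth _ no_labels) => [|t]; rewrite ?size_mkseq ?size_nseq //.
    by move=> lt_t; rewrite nth_mkseq // nth_nseq lt_t.
  by move=> t; rewrite /greedy_label !onth0n; case: ifP.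
by rewrite block_greedy // greedy_order_head ?S_neq0.
Qed.

Lemma size_greedy_block S L h : size (greedy_block S L h) = h.
Proof. exact: size_mkseq. Qed.

Lemma greedy_order_size_rcons S f h (L := greedy_order S f) :
    0 < h -> size L <= (\max_(k <- S) k).+1 ->
  size (greedy_order (rcons S h) (f ++ greedy_block S L h)) <=
  (\max_(k <- rcons S h) k).+1.
Proof.
case: h => // h _ szL.
(* [rest] contains the old rows left free, the skipped row [nth 0 L h] included. If [L] is too
   short, the default 0 may be a spurious entry, harmless for an upper bound. *)
set rest := if h.+1 \in S then nth 0 L h :: drop h.+2 L else drop h.+1 L.
have sz_rest : size rest + h.+1 <= (maxn (\max_(k <- S) k) h.+1).+1.
  rewrite /rest; case: ifP => [hS|_] /=; rewrite size_drop; last by lia.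
  by have := (@leq_bigmax_seq _ S xpredT id h.+1 hS isT); lia.
rewrite -cats1 big_cat big_seq1 cats1; apply: leq_trans sz_rest.
have -> : size rest + h.+1 = size (iota (sumn S) h.+1 ++ rest).
  by rewrite size_cat size_iota addnC.
apply: uniq_leq_size => [|r]; first exact: greedy_uniq.
rewrite mem_greedy sumn_rcons has_one_cat has_one_greedy_block mem_cat mem_iota.
rewrite !negb_or => /and4P[-> r_f r_take r_last]; rewrite andbT.
case: leqP => //= lt_r.
have /onthP[v Lv] : r \in L by rewrite mem_greedy lt_r.
have le_hv : h <= v.
  rewrite leqNgt; apply: contra r_take => lt_v.
  by apply/mem_take_onth; exists v.
have v_neq : v != if h.+1 \in S then h.+1 else h.
  by apply: contraNneq r_last => <-; rewrite Lv.
rewrite /rest; move: v_neq; case: ifP => hS v_neq; last first.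
  by apply: mem_drop_onth Lv; lia.
rewrite inE; have [le_v|gt_v] := leqP v h.
  have vh : v = h by lia.
  by rewrite -vh (onth_nth 0 _ _ _ Lv) eqxx.
by rewrite (mem_drop_onth _ Lv) ?orbT //; lia.
Qed.

(** The last two claims are what the closed form of the next block requires, so all are proved in
    one induction on the columns. *)
Lemma filling_invariant S :
  all (leq 1) S ->
  [/\ size (filling S) = sumn S,
      size (greedy_order S (filling S)) <= (\max_(k <- S) k).+1
    & forall r, has_one (filling S) r -> r < sumn (take (size S).-1 S)].
Proof.
elim/last_ind: S => [|S h IHS]; first by rewrite big_nil.
rewrite all_rcons => /andP[h_gt0 posS]; have [szf szL f_row] := IHS posS.
rewrite filling_greedyS //; split.
- by rewrite size_cat size_greedy_block szf sumn_rcons.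
- exact: greedy_order_size_rcons.
move=> r; rewrite size_rcons /= -cats1 take_size_cat // has_one_cat.
case/orP => [/f_row|].
  by have := leq_sumn_take S (leq_pred (size S)); rewrite take_size; lia.
case: h h_gt0 => // h _; rewrite has_one_greedy_block.
suff mem x : x \in greedy_order S (filling S) -> x < sumn S.
  case/orP => [/mem_take/mem //|/eqP Lr].
  by apply: mem; apply/onthP; eexists; exact: Lr.
by rewrite mem_greedy => /andP[].
Qed.

(** * Labels of a single box of the whole diagram *)

Lemma filling_cat S T : exists g, filling (S ++ T) = filling S ++ g.
Proof.
elim/last_ind: T => [|T h [g IHT]]; first by exists [::]; rewrite !cats0.
by rewrite -rcons_cat filling_rcons IHT -catA; eexists.
Qed.

Definition column_order (c : seq nat) (q : nat) : seq nat :=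
  greedy_order (take q c) (filling (take q c)).

Lemma all_take (T : Type) (a : pred T) n s : all a s -> all a (take n s).
Proof. by rewrite -[X in all a X -> _](cat_take_drop n s) all_cat => /andP[]. Qed.

Lemma nth_filling c b (q := column_of c b) :
    all (leq 1) c -> b < sumn c ->
  nth no_labels (filling c) b =
  greedy_label (take q c) (column_order c q) (nth 0 c q)
               (b - sumn (take q c)).
Proof.
move=> posc lt_b; have := box_bounds lt_b; rewrite -/q => /andP[ge_b lt_b'].
have lt_q : q < size c by apply: reshape_indexP.
have [szf szL f_row] := filling_invariant (all_take q posc).
have [g] := filling_cat (take q.+1 c) (drop q.+1 c); rewrite cat_take_drop => ->.
rewrite (take_nth 0) // filling_greedyS ?all_take //; last first.
  by apply: (allP posc); apply: mem_nth.
rewrite -catA nth_cat szf ltnNge ge_b /= nth_cat size_greedy_block ltn_subLR //.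
by rewrite lt_b' nth_mkseq // ltn_subLR.
Qed.

(** Later columns do not alter earlier labels, so freeness in the truncated diagram can be tested in
    the whole filling. *)
Lemma mem_column_order c q r :
    all (leq 1) c ->
  r \in column_order c q <->
  r < sumn (take q c) /\
  forall b, b < sumn (take q c) -> ~~ carries_one c r b.
Proof.
move=> posc; have [szf _ _] := filling_invariant (all_take q posc).
have [g] := filling_cat (take q c) (drop q c); rewrite cat_take_drop => cE.
rewrite /column_order mem_greedy.
have nthE b : b < sumn (take q c) ->
    nth no_labels (filling (take q c)) b = nth no_labels (filling c) b.
  by rewrite cE nth_cat szf => ->.
split=> [/andP|] [lt_r r_free]; first split=> //.
  move=> b lt_b; apply: contra r_free; rewrite /carries_one -nthE // => rb.
  by apply/(has_nthP no_labels); exists b; rewrite ?szf.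
rewrite lt_r andTb; apply/(has_nthP no_labels) => -[b]; rewrite szf => lt_b.
by rewrite nthE // => rb; case/negP: (r_free b lt_b).
Qed.

Definition box_offset (c : seq nat) (b : nat) : nat :=
  b - sumn (take (column_of c b) c).

(* The position in [column_order] of the row of the 1 in column b, if any. *)
Definition one_index (c : seq nat) (b : nat) : nat :=
  let q := column_of c b in let h := nth 0 c q in
  if ((box_offset c b).+1 == h) && (h \in take q c) then h else box_offset c b.

Lemma carries_oneE c r b :
    all (leq 1) c -> b < sumn c ->
  carries_one c r b =
  (onth (column_order c (column_of c b)) (one_index c b) == Some r).
Proof.
move=> posc lt_b; rewrite /carries_one nth_filling // /greedy_label /one_index.
by rewrite -/(box_offset c b); case: ifP.
Qed.

Lemma carries_starE c r b (q := column_of c b) (h := nth 0 c q) :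
    all (leq 1) c -> b < sumn c -> (box_offset c b).+1 = h -> h \in take q c ->
  carries_star c r b = (onth (column_order c q) h.-1 == Some r).
Proof.
move=> posc lt_b hb hS; rewrite /carries_star nth_filling // /greedy_label.
by rewrite -/(box_offset c b) -/q -/h hb eqxx hS -[in RHS]hb.
Qed.

Lemma box_offset_lt c b : b < sumn c -> box_offset c b < nth 0 c (column_of c b).
Proof. by move=> /box_bounds; rewrite /box_offset; lia. Qed.

Lemma column_order_lt_take c q v x :
  onth (column_order c q) v = Some x -> x < sumn (take q c).
Proof.
move=> Lv; have : x \in column_order c q by apply/onthP; exists v.
by rewrite mem_greedy => /andP[].
Qed.

Lemma ltn_sumn_take_sumn c q b : b < sumn (take q c) -> b < sumn c.
Proof. by move=> lt_b; rewrite -(cat_take_drop q c) sumn_cat; lia. Qed.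

Lemma column_order_sorted c q u v x y (L := column_order c q) :
    u < v -> onth L u = Some x -> onth L v = Some y ->
  (column_of c y < column_of c x) || (column_of c x == column_of c y) && (x < y).
Proof.
move=> uv Lu Lv.
have lt_u : u < size L by rewrite -onthTE Lu.
have lt_v : v < size L by rewrite -onthTE Lv.
have := sort_sorted (@box_le_total (take q c))
  (free_rows (take q c) (filling (take q c))).
move=> /(sorted_ltn_nth (@box_le_trans _) 0)/(_ u v lt_u lt_v uv).
have := nth_uniq 0 lt_u lt_v (greedy_uniq _ _).
rewrite -/(greedy_order _ _) -/(column_order c q) -/L.
rewrite (onth_nth 0 _ _ _ Lu) (onth_nth 0 _ _ _ Lv) /box_le.
by rewrite !column_of_take ?(column_order_lt_take Lu)
  ?(column_order_lt_take Lv) //; lia.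
Qed.

(** The last condition excludes the skipped row; every other row among the first [nth 0 c q] gets
    its 1 in the box at its own position. *)
Lemma column_order_carries_one c q v r :
    all (leq 1) c -> onth (column_order c q) v = Some r ->
    v < nth 0 c q -> (v.+1 == nth 0 c q) && (nth 0 c q \in take q c) = false ->
  carries_one c r (sumn (take q c) + v).
Proof.
move=> posc Lv lt_v not_last.
have lt_b : sumn (take q c) + v < sumn c.
  by apply: (@ltn_sumn_take_sumn _ q.+1); rewrite sumn_takeS; lia.
have col_b := column_of_flatten lt_v.
by rewrite carries_oneE // /one_index /box_offset col_b addKn not_last Lv.
Qed.

Lemma carries_one_column c r b :
    all (leq 1) c -> b < sumn c -> carries_one c r b ->
  column_of c r < column_of c b.
Proof.
move=> posc lt_b; rewrite carries_oneE // => /eqP/column_order_lt_take lt_r.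
by rewrite -ltn_sumn_take // (ltn_sumn_take_sumn lt_r).
Qed.

(** * Bad pairs *)

(** The last two hypotheses are the two halves of badness, with root vectors expressed by comparing
    columns. *)
Lemma bad_pair_carries_star c i j k l :
    all (leq 1) c -> [/\ i < sumn c, j < sumn c, k < sumn c & l < sumn c] ->
    carries_one c i j -> carries_one c k l -> j != k -> ~~ carries_star c j l ->
    column_of c j <= column_of c k ->
    (forall z, z < sumn c -> carries_one c j z -> z != l ->
       column_of c l < column_of c z) ->
    (forall y, y < sumn c -> carries_one c y k -> y != i ->
       column_of c y < column_of c i) ->
  carries_star c j k.
Proof.
move=> posc [lt_i lt_j lt_k lt_l] one_ij one_kl jk nstar_jl le_jk bad_row bad_col.
have col_ij := carries_one_column posc lt_j one_ij.
have col_kl := carries_one_column posc lt_l one_kl.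
have j_late z : z < sumn c -> carries_one c j z -> column_of c l < column_of c z.
  move=> lt_z one_jz; apply: bad_row => //; apply: contraNneq jk => zl.
  by move: one_jz one_kl; rewrite zl /carries_one => /eqP-> /eqP[->].
(* Up to the column of [l], a position of [j] below the height of the block must be that of the
   skipped row; otherwise row [j] would get a 1 too early. *)
have j_unused q v : q <= column_of c l -> onth (column_order c q) v = Some j ->
    (v < nth 0 c q) ==> (v.+1 == nth 0 c q) && (nth 0 c q \in take q c).
  move=> le_q Lv; apply/implyP => lt_v; apply/negPn/negP => /negbTE not_last.
  have lt_b : sumn (take q c) + v < sumn c.
    by apply: (@ltn_sumn_take_sumn _ q.+1); rewrite sumn_takeS; lia.
  have := column_order_carries_one posc Lv lt_v not_last.
  by move/(j_late _ lt_b); rewrite column_of_flatten //; lia.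
have j_free q : column_of c j < q -> q <= column_of c l ->
    exists v, onth (column_order c q) v = Some j.
  move=> lt_q le_q; apply/onthP/mem_column_order => //.
  split=> [|b lt_b]; first by rewrite ltn_sumn_take.
  have lt_bc := ltn_sumn_take_sumn lt_b.
  apply/negP => /(j_late _ lt_bc); rewrite ltn_sumn_take // in lt_b; lia.
(* Otherwise the row [y] of the 1 in column [k] strictly precedes [x], so it is neither [i] nor in a
   column left of that of [i], against [bad_col]. *)
have k_row v x : onth (column_order c (column_of c k)) v = Some x ->
    (x == i) || (column_of c i < column_of c x) -> v <= one_index c k.
  move=> Lv x_i; rewrite leqNgt; apply/negP => lt_v.
  have : onth (column_order c (column_of c k)) (one_index c k).
    by rewrite onthTE (ltn_trans lt_v) // -onthTE Lv.
  case Lw: (onth _ _) => [y|] // _.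
  have lt_y := ltn_sumn_take_sumn (column_order_lt_take Lw).
  have := bad_col y lt_y; rewrite carries_oneE // Lw eqxx => /(_ isT).
  have := column_order_sorted lt_v Lw Lv; case: (eqVneq y i) => [->|_].
    by case: eqP x_i => [->|_] /=; lia.
  by case: eqP x_i => [->|_] /=; lia.
have lt_dk := box_offset_lt lt_k; have lt_dl := box_offset_lt lt_l.
move: le_jk; rewrite leq_eqVlt => /predU1P[eq_jk|lt_jk]; last first.
  have [v Lv] := j_free _ lt_jk (ltnW col_kl).
  have v_neq : v != one_index c k.
    apply/eqP => vk; have := j_late k lt_k.
    by rewrite carries_oneE // -vk Lv eqxx => /(_ isT); lia.
  have last_v := j_unused _ v (ltnW col_kl) Lv.
  have le_v : v <= one_index c k by apply: k_row Lv _; rewrite col_ij orbT.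
  (* Here [v < one_index c k], so [v] is below the height and [j] is the skipped row; then [v] is
     the last offset, which leaves [k] as the last box. *)
  have [kh hS vh] : [/\ (box_offset c k).+1 = nth 0 c (column_of c k),
      nth 0 c (column_of c k) \in take (column_of c k) c
    & v = (nth 0 c (column_of c k)).-1].
    move: v_neq le_v last_v; rewrite /one_index.
    case: ifP => [/andP[/eqP kh hS]|not_last] v_neq le_v; first by split=> //; lia.
    move/implyP/(_ ltac:(lia))/andP => [/eqP vh hS].
    by rewrite hS in not_last; split=> //; lia.
  by rewrite carries_starE // -vh Lv.
have [lt_kj|le_jk] := ltnP k j.
  (* Columns [j] and [k] share one list, where [i] has position [one_index c j], beyond
     [one_index c k] since [k] is above [j]; this contradicts [k_row]. *)
  have := carries_oneE i posc lt_j; rewrite one_ij eq_jk => /esym/eqP Lj.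
  have := k_row _ _ Lj; rewrite eqxx => /(_ isT); have := box_offset_lt lt_j.
  have := box_bounds lt_j; have := box_bounds lt_k.
  rewrite /one_index /box_offset eq_jk; case: ifP; case: ifP; lia.
have lt_jk : j < k by lia.
have := carries_oneE k posc lt_l; rewrite one_kl => /esym/eqP Lk.
have [|v Lv] := j_free (column_of c l) _ (leqnn _); first by rewrite eq_jk.
have := j_unused _ v (leqnn _) Lv.
(* Row [j] precedes row [k], which holds the 1 of column [l]; being skipped, [j] has the star of
   column [l]. *)
have lt_v : v < one_index c l.
  have := column_order_sorted _ Lv Lk; have := column_order_sorted _ Lk Lv.
  case: (ltngtP v (one_index c l)) => // [|vw]; first by lia.
  by move: Lk jk; rewrite -vw Lv => -[->]; rewrite eqxx.
move: lt_v nstar_jl; rewrite /one_index.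
case: ifP => [/andP[/eqP lh hS]|_] lt_v; last by lia.
move=> + /implyP/(_ lt_v)/andP[/eqP vh _].
by rewrite carries_starE // -vh Lv eqxx.
Qed.

Theorem theorem4p4p5 (R : realType) (n : nat) (c : seq nat)
    (hc : is_composition c n) (i j k' l : 'I_n)
    (hbad : bad_VS_pair R c i j k' l) :
  [/\ carries_star c j k',
      supp_V c (matrix_unit R j k')
    & VS_quadruplet R c i j k' l].
Proof.
have [hpair bad_row bad_col] := hbad; have [posc sumc] := hc.
have [[/supp_eP one_ij /supp_eP one_kl] jk _ star_jl] := hpair.
move=> /root_vectorP[_ le_jk].
suff star_jk : carries_star c j k'.
  by split; [| apply/supp_VP | split; last apply/supp_VP].
have lt_sum (b : 'I_n) : b < sumn c by rewrite sumc.
apply: (@bad_pair_carries_star c i j k' l) => //.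
- by apply/negP => star; apply/star_jl/supp_VP.
- move=> z; rewrite sumc => lt_z one_jz zl; rewrite ltnNge; apply/negP => le_zl.
  apply: bad_row; exists (Ordinal lt_z); split; first exact/supp_eP.
  exact/root_vectorP.
move=> y; rewrite sumc => lt_y one_yk yi; rewrite ltnNge; apply/negP => le_iy.
apply: bad_col; exists (Ordinal lt_y); split; first exact/supp_eP.
by apply/root_vectorP; rewrite eq_sym.
Qed.
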